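(* Let $\mathbb G$ be a Carnot group of type $\star$. Then every set $E\subset\mathbb G$ with a constant intrinsic normal is a vertical halfspace.
   Context: A Carnot group $\mathbb G$ of step $\kappa$ is a nilpotent, connected and simply connected Lie group whose Lie algebra $\mathfrak g$ (of left invariant vector fields) has a stratification $\mathfrak g=V_1\oplus\cdots\oplus V_\kappa$ with $[V_1,V_i]=V_{i+1}$, $V_\kappa\ne\{0\}$, $V_i=\{0\}$ for $i>\kappa$, where $[V_1,V_i]$ is the subspace spanned by the brackets $[X,Y]$, $X\in V_1$, $Y\in V_i$. Put $m=\dim V_1$, $n=\dim\mathfrak g$. $\mathbb G$ (or $\mathfrak g$) is of type $\star$ if there exists a basis $(X_1,\dots,X_m)$ of $V_1$ such that $[X_j,[X_j,X_i]]=0$ for all $i,j=1,\dots,m$. Fix any basis $(X_1,\dots,X_n)$ of $\mathfrak g$ adapted to the stratification (the first $m$ vectors form a basis of $V_1$, the next $\dim V_2$ a basis of $V_2$, and so on), and identify $\mathbb G$ with $\mathbb R^n$ via exponential coordinates $p=\exp(p_1X_1+\dots+p_nX_n)$. Lebesgue measure is the Haar measure of $\mathbb G$. Let $\langle\cdot,\cdot\rangle$ be the inner product on $V_1$ making $(X_1,\dots,X_m)$ orthonormal. (This basis need not be the one appearing in the type $\star$ condition.) Derivatives are in the sense of distributions. A measurable set $E\subset\mathbb G$ has locally finite perimeter (is a $\mathbb G$-Caccioppoli set) if $X\mathbf 1_E$ is a (signed) Radon measure for every $X\in V_1$. Its perimeter measure $|\partial E|_{\mathbb G}$ is the total variation of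 the $\mathbb R^m$-valued Radon measure $\nabla_{\mathbb G}\mathbf 1_E=(X_1\mathbf 1_E,\dots,X_m\mathbf 1_E)$; the generalized (inward) intrinsic normal $\nu_E=\sum_{i=1}^m(\nu_E)_iX_i$ is the $|\partial E|_{\mathbb G}$-measurable horizontal section with $\sum_i (\nu_E)_i^2=1$ $|\partial E|_{\mathbb G}$-a.e. and $X_i\mathbf 1_E=(\nu_E)_i\,|\partial E|_{\mathbb G}$ for $i=1,\dots,m$. It is assumed that $|\partial E|_{\mathbb G}$ is non-null when speaking of $\nu_E$. A set $E$ of locally finite perimeter has a constant intrinsic normal if $\nu_E$ is ($|\partial E|_{\mathbb G}$-a.e.) equal to a constant element of $V_1$; equivalently, if there exists $X\in V_1$ such that $X\mathbf 1_E\ge0$, $X\mathbf 1_E\not\equiv0$, and $Y\mathbf 1_E=0$ for every $Y\in V_1$ orthogonal to $X$. A set $H\subset\mathbb G$ is a vertical halfspace if it has a constant intrinsic normal and $Y\mathbf 1_H=0$ for all $Y\in\bigoplus_{i=2}^\kappa V_i$. (Up to a null set, such $H$ can be written as $q\cdot\{x:\sum_{i=1}^m v_ix_i\ge0\}$ for some $q\in\mathbb G$ and some unit vector $v\in\mathbb R^m$.) *)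

(* Defs.v *)
From HB Require Import structures.
From mathcomp Require Import all_boot all_order all_algebra.
From mathcomp Require Import all_classical all_reals all_analysis.
Set Implicit Arguments. Unset Strict Implicit. Unset Printing Implicit Defensive.
Import Order.TTheory GRing.Theory Num.Theory.
Import numFieldNormedType.Exports.
Local Open Scope classical_set_scope.
Local Open Scope ring_scope.

Definition rV_display : measure_display. Proof. exact. Qed.

HB.instance Definition _ (R : realType) (n : nat) :=
  @isMeasurable.Build rV_display 'rV[R]_n (<<s @open 'rV[R]_n >>)
    (@sigma_algebra0 _ _ _) (@sigma_algebraC _ _) (@sigma_algebra_bigcup _ _ _).

Section lebesgue_step.
Variables (R : realType) (n : nat).

Definition consV (xv : measurableTypeR R * 'rV[R]_n) : 'rV[R]_n.+1 :=
  \row_i if unlift ord0 i is Some j then xv.2 0 j else xv.1.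

Lemma coord_measurable m (i : 'I_m) :
  measurable_fun setT (fun v : 'rV[R]_m => (v 0 i : measurableTypeR R)).
Proof.
apply: (measurability _ (measurable_realfun.RGenOpens.measurableE R)).
move=> _ [_ [a [b ->] <-]]; rewrite setTI; apply: sub_sigma_algebra.
apply: open_comp; last exact: interval_open.
by move=> v _; exact: coord_continuous.
Qed.

Definition tailV (v : 'rV[R]_n.+1) : 'rV[R]_n := \row_j v 0 (lift ord0 j).

Lemma tailV_measurable : measurable_fun setT tailV.
Proof.
apply: (measurability (@open 'rV[R]_n)) => //.
move=> _ [U oU <-]; rewrite setTI; apply: sub_sigma_algebra.
apply: open_comp => // v _ A /nbhs_ballP[e e0 eA]; apply/nbhs_ballP.
by exists e => // w [_ vw]; apply: eA; split=> // i j; rewrite !mxE; exact: vw.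
Qed.

Definition rat_box m (q : 'rV[rat]_m * 'rV[rat]_m) : set 'rV[R]_m :=
  [set v | forall i, ratr (q.1 0 i) < v 0 i < ratr (q.2 0 i)].

Lemma open_rV_bigcup m (U : set 'rV[R]_m) : open U ->
  U = \bigcup_q (if `[< rat_box q `<=` U >] then rat_box q else set0).
Proof.
move=> oU; apply/seteqP; split=> [v Uv|v [q _]]; last first.
  by case: asboolP => // + vq; exact.
have /nbhs_ballP[e /= e0 eU] : nbhs v U by exact: open_nbhs_nbhs.
have /choice [q1 q1P] : forall i, exists q : rat, v 0 i - e < ratr q < v 0 i.
  move=> i; have /rat_in_itvoo[q] : v 0 i - e < v 0 i by rewrite ltrBlDr ltrDl.
  by rewrite in_itv/=; exists q.
have /choice [q2 q2P] : forall i, exists q : rat, v 0 i < ratr q < v 0 i + e.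
  move=> i; have /rat_in_itvoo[q] : v 0 i < v 0 i + e by rewrite ltrDl.
  by rewrite in_itv/=; exists q.
pose q := (\row_i q1 i, \row_i q2 i).
exists q => //; case: asboolP => [_|].
  by move=> i; rewrite !mxE; have /andP[_ ->] := q1P i; have /andP[-> _] := q2P i.
case=> w qw; apply: eU; split => // i j.
have := qw j; rewrite !mxE => /andP[w1 w2].
have /andP[h1 h2] := q1P j; have /andP[h3 h4] := q2P j.
rewrite ord1 /ball/= distrC ltr_distl.
by rewrite (lt_trans h1 w1) (lt_trans w2 h4).
Qed.

Lemma consV_measurable : measurable_fun setT consV.
Proof.
apply: (measurability (@open 'rV[R]_n.+1)) => //.
move=> _ [U oU <-]; rewrite setTI (open_rV_bigcup oU) preimage_bigcup.
apply: countable_bigcupT_measurable => [|q]; first exact: countableP.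
case: asboolP => [_|_]; last by rewrite preimage_set0.
have -> : consV @^-1` rat_box q = \bigcap_(i in [set: 'I_n.+1])
    ((fun xv => consV xv 0 i) @^-1` `]ratr (q.1 0 i), ratr (q.2 0 i)[%classic).
  apply/seteqP; split=> xv /= h i; first by move=> _; rewrite /= in_itv/=.
  by have /= := h i I; rewrite in_itv.
apply: fin_bigcap_measurable; first exact: finite_finset.
move=> i _; rewrite -[X in measurable X]setTI.
suff : measurable_fun setT (fun xv => consV xv 0 i : measurableTypeR R).
  by apply=> //; exact: measurable_itv.
have [[j ->]|->] : (exists j : 'I_n, i = lift ord0 j) \/ i = ord0.
  by case: (unliftP ord0 i) => [j ->|->]; [left; exists j|right].
- suff -> : (fun xv => consV xv 0 (lift ord0 j) : measurableTypeR R) =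
      (fun v : 'rV[R]_n => v 0 j : measurableTypeR R) \o snd.
    by apply: measurableT_comp; [exact: coord_measurable|exact: measurable_snd].
  by apply/funext => xv; rewrite /= mxE liftK.
- suff -> : (fun xv => consV xv 0 ord0 : measurableTypeR R) = fst.
    exact: measurable_fst.
  by apply/funext => xv; rewrite mxE unlift_none.
Qed.

Variable m : {sigma_finite_measure set 'rV[R]_n -> \bar R}.

Definition lebesgue_step := pushforward (@lebesgue_measure R \x m)%E consV.

Let preimage_measurable A : measurable A -> measurable (consV @^-1` A).
Proof.
by move=> mA; rewrite -[X in measurable X]setTI; exact: consV_measurable.
Qed.

Let step0 : lebesgue_step set0 = 0%E.
Proof. by rewrite /lebesgue_step /pushforward preimage_set0 measure0. Qed.

Let step_ge0 A : (0 <= lebesgue_step A)%E.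
Proof. by rewrite /lebesgue_step /pushforward measure_ge0. Qed.

Let step_sigma_additive : semi_sigma_additive lebesgue_step.
Proof.
move=> F mF tF mUF; rewrite /lebesgue_step /pushforward preimage_bigcup.
apply: measure_semi_sigma_additive.
- by move=> k; exact: preimage_measurable.
- apply/trivIsetP => /= i j _ _ ij; rewrite -preimage_setI.
  by move/trivIsetP : tF => /(_ _ _ _ _ ij) ->//; rewrite preimage_set0.
- by rewrite -preimage_bigcup; exact: preimage_measurable.
Qed.

HB.instance Definition _ := isMeasure.Build _ _ _ lebesgue_step
  step0 step_ge0 step_sigma_additive.

Lemma lebesgue_step_sigma_finite : sigma_finite setT lebesgue_step.
Proof.
have /sigma_finiteP[F [FT ndF F_]] := sigma_finiteT (@lebesgue_measure R).
have /sigma_finiteP[G [GT ndG G_]] := sigma_finiteT m.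
exists (fun k => (fun v : 'rV[R]_n.+1 => v 0 ord0) @^-1` F k `&` tailV @^-1` G k).
  apply/esym; rewrite -subTset => v _.
  have [i _ Fi] : (\bigcup_k F k) (v 0 ord0) by rewrite -FT.
  have [j _ Gj] : (\bigcup_k G k) (tailV v) by rewrite -GT.
  exists (maxn i j) => //; split.
    by apply: (subsetPset _ _ (ndF _ _ _)) Fi; exact: leq_maxl.
  by apply: (subsetPset _ _ (ndG _ _ _)) Gj; exact: leq_maxr.
move=> k; have [mF Fk] := F_ k; have [mG Gk] := G_ k; split.
  apply: measurableI; rewrite -[X in measurable X]setTI.
    exact: (coord_measurable ord0).
  exact: tailV_measurable.
rewrite /lebesgue_step /pushforward (_ : consV @^-1` _ = F k `*` G k).
  by rewrite product_measure1E// lte_mul_pinfty// ge0_fin_numE.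
apply/seteqP; split=> -[x v] /=;
  rewrite mxE unlift_none (_ : tailV _ = v)//;
  by apply/rowP => i; rewrite !mxE liftK.
Qed.

HB.instance Definition _ :=
  Measure_isSigmaFinite.Build _ _ _ lebesgue_step lebesgue_step_sigma_finite.

End lebesgue_step.

(* The Lebesgue measure on the Borel sets of R^n, as an iterated product. *)
Fixpoint lebesgue_rV (R : realType) (n : nat) :
    {sigma_finite_measure set 'rV[R]_n -> \bar R} :=
  match n with
  | 0 => \d_(0 : 'rV[R]_0)
  | n'.+1 => lebesgue_step (lebesgue_rV R n')
  end.


Lemma lebesgue_rV_box (R : realType) (n : nat) (A : 'I_n -> set R) :
  (forall i, measurable (A i)) ->
  lebesgue_rV R n [set v | forall i, A i (v 0 i)] =
    (\prod_(i < n) @lebesgue_measure R (A i))%E.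
Proof.
elim: n A => [|n IH] A mA.
  by rewrite big_ord0 /= diracE (mem_set _)// => -[].
pose B := [set v : 'rV[R]_n | forall i, A (lift ord0 i) (v 0 i)].
rewrite big_ord_recl -(IH (fun i => A (lift ord0 i)))//=; rewrite -/B.
have mB : measurable B.
  have -> : B = \bigcap_(i in [set: 'I_n])
      ((fun v : 'rV[R]_n => v 0 i : measurableTypeR R) @^-1` A (lift ord0 i)).
    by apply/seteqP; split=> v h i; [move=> _; exact: h|exact: (h i)].
  apply: fin_bigcap_measurable => [|i _]; first exact: finite_finset.
  by rewrite -[X in measurable X]setTI; apply: (coord_measurable i) => //; exact: mA.
rewrite /lebesgue_step /pushforward.
rewrite -(product_measure1E _ _ (mA ord0 : measurable (A ord0 : set (measurableTypeR R))) mB).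
congr (_ _); apply/seteqP; split=> -[x v] /=.
  move=> h; split; first by have := h ord0; rewrite mxE unlift_none.
  by move=> i; have := h (lift ord0 i); rewrite mxE liftK.
move=> [Ax Av] i; rewrite mxE; case: unliftP => [j ->|->] //; exact: Av.
Qed.

(* R^n with the complete Lebesgue sigma-algebra; the Borel one is carried by
   'rV[R]_n itself. *)
Notation lebesgueTypeV R n := (caratheodory_type ((lebesgue_rV R n)^*)%mu).

Definition lebesgueV (R : realType) (n : nat) :
    {measure set (lebesgueTypeV R n) -> \bar R} :=
  @completed_measure_extension _ _ _ (lebesgue_rV R n).

Definition lebesgue_measurable (R : realType) (n : nat) (E : set 'rV[R]_n) :=
  measurable (E : set (lebesgueTypeV R n)).

Section smooth.
Variables (R : realType) (V W : normedModType R).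

(* In finite dimension, f is C^k iff its iterated directional derivatives of
   order at most k exist and are continuous. *)
Fixpoint Ck (k : nat) (f : V -> W) : Prop :=
  continuous f /\
  if k is k'.+1 then
    forall v : V, (forall x, derivable f x v) /\ Ck k' (fun x => 'D_v f x)
  else True.

Definition smooth (f : V -> W) := forall k, Ck k f.

End smooth.

(* phi \in C_c^oo(R^n) *)
Definition test_function (R : realType) (n : nat) (phi : 'rV[R]_n -> R) :=
  smooth phi /\ compact (closure [set p | phi p != 0]).

(* The left invariant vector field of a group law on R^n with value v at 0,
   as a derivation: differentiate f along t |-> p * exp(t v). *)
Definition left_field (R : realType) (n : nat)
    (mul : 'rV[R]_n -> 'rV[R]_n -> 'rV[R]_n) (v : 'rV[R]_n)
    (f : 'rV[R]_n -> R) (p : 'rV[R]_n) : R :=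
  derive1 (fun t : R => f (mul p (t *: v))) 0.

Definition weight_layer (R : realType) (n : nat) (w : 'I_n -> nat) (k : nat) :
    {vspace 'rV[R]_n} :=
  <<[seq delta_mx 0%R i | i <- enum 'I_n & w i == k]>>%VS.

(* Z = [U, W], the linear span of the brackets. *)
Definition bracket_span (R : realType) (n : nat)
    (br : 'rV[R]_n -> 'rV[R]_n -> 'rV[R]_n) (U W Z : {vspace 'rV[R]_n}) :=
  (forall x y, x \in U -> y \in W -> br x y \in Z) /\
  (forall Z' : {vspace 'rV[R]_n},
     (forall x y, x \in U -> y \in W -> br x y \in Z') -> (Z <= Z')%VS).

(* A Carnot group read in the exponential coordinates of a basis
   (X_0, ..., X_(n-1)) of its Lie algebra g adapted to the stratification.
   The group is a Lie group structure on R^n with identity 0; carnot_exp says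
   that t |-> t p is the one-parameter subgroup with velocity p at 0, that is
   p = exp(p_0 X_0 + ... + p_(n-1) X_(n-1)); in particular p^-1 = - p.
   A vector v of R^n stands for the element X_v = v_0 X_0 + ... of g, the left
   invariant vector field with value v at 0, and carnot_bracketE says that
   the bracket of g is the commutator of vector fields. The basis vector X_i
   lies in the layer V_(w i), where w = carnot_weight. *)
Record carnotGroup (R : realType) (n : nat) := CarnotGroup {
  carnot_step : nat ;
  carnot_weight : 'I_n -> nat ;
  carnot_mul : 'rV[R]_n -> 'rV[R]_n -> 'rV[R]_n ;
  carnot_bracket : 'rV[R]_n -> 'rV[R]_n -> 'rV[R]_n ;
  carnot_mulA : associative carnot_mul ;
  carnot_mul0p : left_id 0 carnot_mul ;
  carnot_mulp0 : right_id 0 carnot_mul ;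
  carnot_smooth :
    smooth (fun pq : 'rV[R]_n * 'rV[R]_n => carnot_mul pq.1 pq.2) ;
  carnot_exp : forall (s t : R) (p : 'rV[R]_n),
    carnot_mul (s *: p) (t *: p) = (s + t) *: p ;
  carnot_bracketE : forall (u v : 'rV[R]_n) (f : 'rV[R]_n -> R),
    smooth f -> forall p,
    let X := left_field carnot_mul in
    X (carnot_bracket u v) f p = X u (X v f) p - X v (X u f) p ;
  carnot_weight_range : forall i, (0 < carnot_weight i <= carnot_step)%N ;
  carnot_weight_homo : {homo carnot_weight : i j / (i <= j)%N} ;
  carnot_step_neq0 : weight_layer R carnot_weight carnot_step != 0%VS ;
  carnot_stratified : forall k, (0 < k)%N ->
    bracket_span carnot_bracket (weight_layer R carnot_weight 1%N)
      (weight_layer R carnot_weight k) (weight_layer R carnot_weight k.+1)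
}.

Section carnot.
Variables (R : realType) (n : nat) (G : carnotGroup R n).
Implicit Types (E : set 'rV[R]_n) (v : 'rV[R]_n) (phi : 'rV[R]_n -> R).
Implicit Types (P : {measure set 'rV[R]_n -> \bar R}) (nu : 'rV[R]_n -> 'rV[R]_n).

Definition layer (k : nat) : {vspace 'rV[R]_n} :=
  weight_layer R (carnot_weight G) k.

Definition vfield v phi := left_field (carnot_mul G) v phi.

Definition type_star :=
  exists b : (\dim (layer 1%N)).-tuple 'rV[R]_n,
    basis_of (layer 1%N) b /\
    forall i j, let br := carnot_bracket G in
      br (tnth b j) (br (tnth b j) (tnth b i)) = 0.

(* The norm of the inner product on V_1 for which the given basis is
   orthonormal. *)
Definition hnorm v : R :=
  Num.sqrt (\sum_(i < n | carnot_weight G i == 1%N) v 0 i ^+ 2).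

(* The distribution X_v 1_E. The Lebesgue measure being a right Haar measure,
   X_v is divergence free, so that its formal adjoint is - X_v. *)
Definition Dind E v phi : R := - \int[lebesgueV R n]_(p in E) vfield v phi p.

Definition Dind_eq0 E v := forall phi, test_function phi -> Dind E v phi = 0.

Definition radon P := forall K : set 'rV[R]_n, compact K -> (P K < +oo)%E.

(* X_v 1_E is the signed Radon measure mup - mum. *)
Definition Dind_is_measure E v (mup mum : {measure set 'rV[R]_n -> \bar R}) :=
  [/\ radon mup, radon mum &
    forall phi, test_function phi ->
      Dind E v phi = \int[mup]_p phi p - \int[mum]_p phi p].

Definition caccioppoli E :=
  lebesgue_measurable E /\
  forall v, v \in layer 1%N -> exists mup mum, Dind_is_measure E v mup mum.

(* The total variation on A of the R^m-valued measure (mup i - mum i)_i, where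
   i ranges over the m indices of weight 1. *)
Definition gradient_variation
    (mup mum : 'I_n -> {measure set 'rV[R]_n -> \bar R})
    (A : set 'rV[R]_n) : \bar R :=
  ereal_sup [set (\sum_(k <oo)
      (hnorm (\row_i (fine (mup i (F k)) - fine (mum i (F k)))))%:E)%E |
    F in [set F : (set 'rV[R]_n)^nat |
      [/\ forall k, measurable (F k), trivIset setT F & \bigcup_k F k = A]]].

(* P = |dE|_G. The components of the gradient of 1_E are finite on bounded
   sets only, and those sets determine P. *)
Definition is_perimeter E P :=
  exists mup mum : 'I_n -> {measure set 'rV[R]_n -> \bar R},
    (forall i, carnot_weight G i = 1%N ->
       Dind_is_measure E (delta_mx 0 i) (mup i) (mum i)) /\
    (forall A : set 'rV[R]_n, measurable A -> bounded_set A ->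
       P A = gradient_variation mup mum A).

(* nu is the horizontal normal nu_E, given P = |dE|_G. *)
Definition is_normal E P nu :=
  [/\ measurable_fun setT nu,
      forall p, nu p \in layer 1%N,
      {ae P, forall p, \sum_(i < n | carnot_weight G i == 1%N) nu p 0 i ^+ 2 = 1} &
      forall i, carnot_weight G i = 1%N ->
        forall phi, test_function phi ->
          Dind E (delta_mx 0 i) phi = \int[P]_p (phi p * nu p 0 i)].

Definition constant_normal E :=
  caccioppoli E /\
  exists P nu, [/\ is_perimeter E P, P setT != 0%E, is_normal E P nu &
    exists2 v, v \in layer 1%N & {ae P, forall p, nu p = v}].

Definition vertical_halfspace E :=
  constant_normal E /\
  forall v, v \in (\sum_(2 <= k < (carnot_step G).+1) layer k)%VS ->
    Dind_eq0 E v.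

End carnot.

(* Main.v *)
Require Import Defs.
From mathcomp Require Import all_boot all_order all_algebra.
From mathcomp Require Import all_classical all_reals all_analysis.
From mathcomp Require Import measurable_realfun ring lra.
Set Implicit Arguments. Unset Strict Implicit. Unset Printing Implicit Defensive.
Import Order.TTheory GRing.Theory Num.Theory.
Import numFieldNormedType.Exports.

Local Open Scope classical_set_scope.
Local Open Scope ring_scope.

(** Call a direction [v] of the Lie algebra invariant when [X_v 1_E = 0]. The
    invariant directions form a Lie subalgebra, because [X_[u, v]] is the
    commutator of [X_u] and [X_v]. If the normal is the constant [d], and [l u]
    denotes the scalar product of [u] and [d], then [X_u 1_E] is [l u] times a
    positive measure for every horizontal [u] ([Dind_constant_normal]); hence
    the horizontal kernel of [l] is invariant. The theorem says that all the
    layers beyond the first one are invariant too.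

    The analytic step is [Dind_bracket_eq0]: if [v] is invariant, [u] is
    horizontal and [[v, [v, u]] = 0], then [[v, u]] is invariant. Indeed, let
    [phi_t p = phi (p exp (t v))] for a nonnegative test function [phi]. The
    number [<X_u 1_E, phi_t>] depends on [t] in an affine way: its derivative is
    [<X_[u, v] 1_E, phi_t>], since [X_v 1_E = 0], and its second derivative is
    [<X_[[u, v], v] 1_E, phi_t> = 0]. It also keeps the sign of [l u], hence it
    is constant and [<X_[u, v] 1_E, phi> = 0]. Since [X_u 1_E] is a measure, the
    derivatives in [t] are obtained by differentiating only [phi_t], under the
    integral sign, and derivatives of [phi] in two directions need not be exchanged.

    Let [b] be a basis of the first layer with [[b_j, [b_j, b_i]] = 0]. If one
    of [b_i], [b_j] is in the kernel of [l], the analytic step shows that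
    [[b_i, b_j]] is invariant; otherwise it applies to the combination
    [l b_j b_i - l b_i b_j], with the same result ([Inv_star_br]). So the second
    layer is invariant. If the whole first layer is in the kernel of [l], it is
    invariant and generates the Lie algebra. If not, let [X] be some [b_j] with
    [l X <> 0], so that [ad X] vanishes at order two on the first layer. The Lie
    algebra generated by the horizontal kernel of [l] and its image by [ad X] is
    made of invariant directions, and is stable under [ad X] because [ad X] is a
    derivation; it is therefore stable under the bracket with the first layer
    and contains all the further layers ([layer_kernel_algebra]). *)

(** * Directional derivatives and smooth functions *)

Section calculus.
Variable R : realType.
Implicit Types U V W : normedModType R.

(** The derivative of [f] at [a] along [v] depends only on the restriction of [f]
    to a line, which may be reparametrized in another space. *)
Lemma eq_quotient U V W (f : V -> W) (g : U -> W) a v b u :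
  (forall h : R, f (h *: v + a) = g (h *: u + b)) ->
  (fun h : R => h^-1 *: (f (h *: v + a) - f a)) =
  (fun h : R => h^-1 *: (g (h *: u + b) - g b)).
Proof.
move=> fg; have fa : f a = g b by have := fg 0; rewrite !scale0r !add0r.
by apply/funext => h; rewrite fg fa.
Qed.

Lemma eq_derivable U V W (f : V -> W) (g : U -> W) a v b u :
  (forall h : R, f (h *: v + a) = g (h *: u + b)) ->
  derivable g b u -> derivable f a v.
Proof. by move=> /eq_quotient fg; rewrite /derivable /= fg. Qed.

Lemma eq_derive U V W (f : V -> W) (g : U -> W) a v b u :
  (forall h : R, f (h *: v + a) = g (h *: u + b)) ->
  'D_v f a = 'D_u g b.
Proof. by move=> /eq_quotient fg; rewrite /derive /= fg. Qed.

Lemma derivable_scale V (f : V -> R) x (c : R) v :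
  derivable f x v -> derivable f x (c *: v) /\ 'D_(c *: v) f x = c * 'D_v f x.
Proof.
move=> fv; pose g (h : R) := f (h *: v + x).
have /derivable1_diffP dg : derivable g 0 1 by exact/(derivable1P f x v).1.
have dgc : differentiable (g \o *:%R c) (0 : R).
  by apply: differentiable_comp => //=; rewrite scaler0.
have e h : f (h *: (c *: v) + x) = (g \o *:%R c) (h *: 1 + 0).
  by rewrite /g /= addr0 scalerA [h *: 1]mulr1 /GRing.scale/= [h * c]mulrC.
have d1 : derivable (g \o *:%R c) (0 : R) 1 by exact: diff_derivable.
split; first exact: (eq_derivable e d1).
rewrite (eq_derive e) -derive1E derive1_comp; last 2 first.
  by apply/derivable1_diffP.
  by rewrite /= scaler0; apply/derivable1_diffP.
rewrite /= scaler0 mulrC; congr (_ * _).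
  rewrite derive1E (@deriveZ R R R id c 0 1); last exact: derivable_id.
  by rewrite derive_id [_ *: _]mulr1.
rewrite derive1E; apply: eq_derive => h.
by rewrite /g [h *: 1]mulr1 addr0.
Qed.

Lemma mean_value V (f : V -> R) v x : (forall y, derivable f y v) ->
  exists2 t : R, 0 <= t <= 1 & f (x + v) - f x = 'D_v f (x + t *: v).
Proof.
move=> df; pose g (t : R) := f (x + t *: v).
have dg t : is_derive (t : R) 1 g ('D_v f (x + t *: v)).
  have e h : g (h *: 1 + t) = f (h *: v + (x + t *: v)).
    by rewrite /g [h *: 1]mulr1 scalerDl addrCA.
  by apply: DeriveDef; [apply: eq_derivable e _|apply: eq_derive].
have cg : {within `[0, 1], continuous g}.
  by apply: derivable_within_continuous => t _; case: (dg t).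
have [t] := MVT_segment ler01 (fun t _ => dg t) cg.
rewrite in_itv/= => t01; rewrite /g scale1r scale0r addr0 subr0 mulr1 => e.
by exists t.
Qed.

Lemma cvg_near_point V (f : V -> R) (e : R -> V) (d : R -> R) x
    (F : set_system R) :
  Filter F -> {for x, continuous f} -> (forall h, `|e h| <= d h) ->
  d h @[h --> F] --> (0 : R) -> f (x + e h) @[h --> F] --> f x.
Proof.
move=> FF cf ed d0; apply: (cvg_comp (fun h => x + e h) f _ cf).
suff: (fun h => x + e h) h @[h --> F] --> x + 0 by rewrite addr0.
apply: cvgD; first exact: cvg_cst.
apply/cvgr0Pnorm_le => r r0; near=> h; apply: (le_trans (ed h)).
apply: (le_trans (ler_norm _)).
by near: h; exact: ((cvgr0Pnorm_le _).1 d0).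
Unshelve. all: by end_near. Qed.

Lemma norm_segment_le V (t : R) (u : V) : 0 <= t <= 1 -> `|t *: u| <= `|u|.
Proof. by move=> /andP[t0 t1]; rewrite normrZ ler_piMl// ger0_norm. Qed.

(** Both increments of [f] along the broken line from [x] to [x + h (u + v)]
    are controlled: the first by derivability along [u] at [x], the second by
    the mean value theorem and the continuity of the derivative along [v]. *)
Lemma derive_dirD V (f : V -> R) x u v : Ck 1 f ->
  'D_(u + v) f x = 'D_u f x + 'D_v f x.
Proof.
move=> [cf df].
have dfv w y : derivable f y w by case: (df w).
have cdf w : continuous ('D_w f) by case: (df w) => _ [].
have /choice [t tP] : forall h : R, exists t : R, 0 <= t <= 1 /\
    f (h *: u + x + h *: v) - f (h *: u + x) =
    'D_(h *: v) f (h *: u + x + t *: (h *: v)).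
  move=> h; have [t t01 e] := mean_value (h *: u + x) (dfv (h *: v)).
  by exists t.
apply: cvg_lim => //.
have : (h^-1 *: (f (h *: u + x) - f x) +
    'D_v f (x + (h *: u + t h *: (h *: v)))) @[h --> 0^'] -->
    'D_u f x + 'D_v f x.
  apply: cvgD; first exact: dfv.
  apply: (@cvg_near_point _ ('D_v f) _ (fun h => `|h| * (`|u| + `|v|))).
  - exact: cdf.
  - move=> h; apply: (le_trans (ler_normD _ _)); rewrite mulrDr.
    apply: lerD; first by rewrite normrZ.
    by rewrite -normrZ; apply: norm_segment_le; case: (tP h).
  - rewrite -[X in _ --> X](mul0r (`|u| + `|v|)); apply: cvgM; last exact: cvg_cst.
    by apply/norm_cvg0P; apply: cvg_within_filter; exact: cvg_id.
apply: cvg_trans; apply: near_eq_cvg; near=> h.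
have h0 : h != 0 by near: h; exact: nbhs_dnbhs_neq.
have [_ e] := tP h.
rewrite /= [h *: (u + v)]scalerDr [h *: u + h *: v + x]addrAC.
rewrite -(subrKA (f (h *: u + x)) (f (h *: u + x + h *: v))) e.
rewrite (derivable_scale h (dfv v _)).2 addrC [in RHS]scalerDr; congr (_ + _).
by rewrite /GRing.scale/= mulKf// addrCA addrA.
Unshelve. all: by end_near. Qed.

Lemma derive_dirZ V (f : V -> R) x (c : R) v : Ck 1 f ->
  'D_(c *: v) f x = c * 'D_v f x.
Proof. by move=> [_ df]; apply: (derivable_scale _ _).2; case: (df v). Qed.

Lemma derive_coord n (f : 'rV[R]_n -> R) x v : Ck 1 f ->
  'D_v f x = \sum_i v 0 i * 'D_(delta_mx 0 i) f x.
Proof.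
move=> f1; rewrite {1}(row_sum_delta v).
elim/big_ind2 : _ => [|u a w b <- <-|i _]; first exact: derive0.
- exact: derive_dirD.
- exact: derive_dirZ.
Qed.

(** The increment of [f] along [g] is, by the mean value theorem, a directional
    derivative of [f] in the direction of the increment of [g]. *)
Lemma chain_rV n V (f : 'rV[R]_n -> R) (g : V -> 'rV[R]_n) x v :
  Ck 1 f -> derivable g x v ->
  is_derive x v (f \o g) (\sum_i ('D_v g x) 0 i * 'D_(delta_mx 0 i) f (g x)).
Proof.
move=> f1 dg; have [cf df] := f1.
have dfv w y : derivable f y w by case: (df w).
have cdf w : continuous ('D_w f) by case: (df w) => _ [].
pose D h := g (h *: v + x) - g x.
have D0 : `|D h| @[h --> 0^'] --> (0 : R).
  have : `|h *: (h^-1 *: D h)| @[h --> 0^'] --> `|(0 : R) *: 'D_v g x|.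
    apply: cvg_norm; apply: cvgZ; last exact: dg.
    by apply: cvg_within_filter; exact: cvg_id.
  rewrite scale0r normr0; apply: cvg_trans; apply: near_eq_cvg; near=> h.
  have h0 : h != 0 by near: h; exact: nbhs_dnbhs_neq.
  by rewrite scalerA divff// scale1r.
have /choice [t tP] : forall h : R, exists t : R, 0 <= t <= 1 /\
    f (g x + D h) - f (g x) = 'D_(D h) f (g x + t *: D h).
  by move=> h; have [t t01 e] := mean_value (g x) (dfv (D h)); exists t.
suff cv : (h^-1 *: ((f \o g) (h *: v + x) - (f \o g) x)) @[h --> 0^'] -->
   \sum_i ('D_v g x) 0 i * 'D_(delta_mx 0 i) f (g x).
  by apply: DeriveDef; [apply/cvg_ex; eexists; exact: cv|exact: cvg_lim].
have : (\sum_i (h^-1 *: D h) 0 i * 'D_(delta_mx 0 i) f (g x + t h *: D h))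
    @[h --> 0^'] --> \sum_i ('D_v g x) 0 i * 'D_(delta_mx 0 i) f (g x).
  apply: cvg_big => [|i _]; first exact: add_continuous.
  apply: cvgM.
    apply: (cvg_comp (fun h => h^-1 *: D h) (fun w : 'rV[R]_n => w 0 i)).
      exact: dg.
    exact: coord_continuous.
  apply: (@cvg_near_point _ ('D_(delta_mx 0 i) f) _ (fun h => `|D h|)) => //.
    exact: cdf.
  by move=> h; apply: norm_segment_le; case: (tP h).
apply: cvg_trans; apply: near_eq_cvg; near=> h.
have [_ e] := tP h.
rewrite /= [g (_ + _)](_ : _ = g x + D h); last by rewrite /D addrCA subrr addr0.
rewrite e (derive_coord _ _ f1) scaler_sumr; apply: eq_bigr => i _.
by rewrite mxE scalerAl.
Unshelve. all: by end_near. Qed.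


Lemma Ck_continuous k V W (f : V -> W) : Ck k f -> continuous f.
Proof. by case: k => [|k] []. Qed.

Lemma CkS k V W (f : V -> W) : Ck k.+1 f -> Ck k f.
Proof.
elim: k f => [|k IH] f [cf df]; first by split.
by split=> // v; have [d1 d2] := df v; split=> //; exact: IH.
Qed.

Lemma Ck1 k V W (f : V -> W) : Ck k.+1 f -> Ck 1 f.
Proof. by elim: k => // k IH; move/CkS. Qed.

Lemma Ck_cst k V W (c : W) : Ck k (fun _ : V => c).
Proof.
elim: k c => [|k IH] c; split=> //; try exact: cst_continuous.
move=> v; split=> [x|]; first exact: derivable_cst.
by rewrite [X in Ck k X](_ : _ = fun=> 0)//; apply/funext => x; exact: derive_cst.
Qed.

Lemma CkD k V W (f g : V -> W) :
  Ck k f -> Ck k g -> Ck k (fun x => f x + g x).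
Proof.
elim: k f g => [|k IH] f g [cf df] [cg dg]; split=> //;
  try by move=> x; apply: continuousD; [exact: cf|exact: cg].
move=> v; have [d1 f'] := df v; have [d2 g'] := dg v; split.
  by move=> x; exact: (derivableD (d1 x) (d2 x)).
rewrite [X in Ck k X](_ : _ = fun x => 'D_v f x + 'D_v g x).
  exact: IH.
by apply/funext => x; exact: deriveD.
Qed.

Lemma CkM k V (f g : V -> R) :
  Ck k f -> Ck k g -> Ck k (fun x => f x * g x).
Proof.
elim: k f g => [|k IH] f g fk gk; have [cf df] := fk; have [cg dg] := gk;
  split=> //; try by move=> x; apply: continuousM; [exact: cf|exact: cg].
move=> v; have [d1 f'] := df v; have [d2 g'] := dg v; split.
  by move=> x; exact: (derivableM (d1 x) (d2 x)).
rewrite [X in Ck k X](_ : _ = fun x => f x * 'D_v g x + g x * 'D_v f x).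
  by apply: CkD; apply: IH => //; exact: CkS.
by apply/funext => x; exact: deriveM.
Qed.

Lemma Ck_sum k V W (I : Type) (r : seq I) (f : I -> V -> W) :
  (forall i, Ck k (f i)) -> Ck k (fun x => \sum_(i <- r) f i x).
Proof.
move=> fk; elim: r => [|i r IH].
  under eq_fun do rewrite big_nil; exact: Ck_cst.
by under eq_fun do rewrite big_cons; exact: CkD.
Qed.

Lemma Ck_coord k V n (g : V -> 'rV[R]_n) i :
  Ck k g -> Ck k (fun x => g x 0 i).
Proof.
elim: k g => [|k IH] g [cg dg]; split=> //;
  try by move=> x; apply: (cvg_comp _ (fun w : 'rV[R]_n => w 0 i) (cg x));
         exact: coord_continuous.
move=> v; have [d1 g'] := dg v; split=> [x|].
  exact: ((derivable_mxP g x v).1 (d1 x)).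
rewrite [X in Ck k X](_ : _ = fun x => 'D_v g x 0 i); first exact: IH.
by apply/funext => x; rewrite derive_mx// mxE.
Qed.

(** By the chain rule the derivatives of [f \o g] are sums of products of
    derivatives of [g] by compositions of lower order. *)
Lemma Ck_comp k V n (f : 'rV[R]_n -> R) (g : V -> 'rV[R]_n) :
  Ck k f -> Ck k g -> Ck k (f \o g).
Proof.
elim: k f g => [|k IH] f g fk gk; have [cf df] := fk; have [cg dg] := gk;
  split=> //; try by move=> x; apply: continuous_comp; [exact: cg|exact: cf].
move=> v; have [d1 g'] := dg v.
have d2 x := chain_rV (Ck1 fk) (d1 x).
split=> [x|]; first by case: (d2 x).
rewrite [X in Ck k X](_ : _ =
    fun x => \sum_i ('D_v g x) 0 i * 'D_(delta_mx 0 i) f (g x)).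
  apply: Ck_sum => i; apply: CkM; first exact: Ck_coord.
  exact: (IH _ _ (df (delta_mx 0 i)).2 (CkS gk)).
by apply/funext => x; case: (d2 x).
Qed.

Lemma Ck_affine k U V W (f : V -> W) (A : U -> V) (L : U -> V) :
  continuous A -> (forall (h : R) v x, A (h *: v + x) = h *: L v + A x) ->
  Ck k f -> Ck k (f \o A).
Proof.
move=> cA AL; elim: k f => [|k IH] f [cf df]; split=> //;
  try by move=> x; apply: continuous_comp; [exact: cA|exact: cf].
move=> v; have [d1 f'] := df (L v).
have e x h : (f \o A) (h *: v + x) = f (h *: L v + A x) by rewrite /= AL.
split=> [x|]; first exact: (eq_derivable (e x)).
rewrite [X in Ck k X](_ : _ = 'D_(L v) f \o A); first exact: IH.
by apply/funext => x; exact: eq_derive.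
Qed.

End calculus.

(** * Test functions *)

Section test_functions.
Variables (R : realType) (n : nat).
Implicit Types (phi psi : 'rV[R]_n -> R) (K : set 'rV[R]_n).

Lemma rV_compact_closed K : compact K -> closed K.
Proof. by apply: compact_closed; exact: norm_hausdorff. Qed.

Lemma test_functionI phi K : smooth phi -> compact K ->
  (forall p, ~ K p -> phi p = 0) -> test_function phi.
Proof.
move=> sphi cK phi0; split=> //; apply: (subclosed_compact _ cK).
  exact: closed_closure.
rewrite [K](closure_id K).1; last exact: rV_compact_closed.
by apply: closure_subset => p /= /eqP pp; apply: contrapT => /phi0.
Qed.

Lemma test_functionE phi : test_function phi ->
  exists K, compact K /\ forall p, ~ K p -> phi p = 0.
Proof.
move=> [_ cK]; exists (closure [set p | phi p != 0]); split=> // p Kp.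
by apply/eqP; apply: contra_notT Kp => ?; exact: subset_closure.
Qed.

Lemma test_function_continuous phi : test_function phi -> continuous phi.
Proof. by move=> [sphi _]; exact: (Ck_continuous (sphi 0%N)). Qed.

Lemma test_function_bounded phi : test_function phi ->
  exists2 M : R, 0 <= M & forall p, `|phi p| <= M.
Proof.
move=> tphi; have [K [cK phi0]] := test_functionE tphi.
have [[q Kq]|K0] := pselect (K !=set0); last first.
  exists 0 => // p; rewrite phi0 ?normr0// => Kp; apply: K0; by exists p.
have cn : {within K, continuous (fun p => `|phi p|)}.
  apply: continuous_subspaceT => p.
  apply: (@continuous_comp _ _ _ phi (fun x => `|x|)).
    exact: test_function_continuous.
  exact: norm_continuous.
have [c _ cmax] := compact_EVT_max (ex_intro _ q Kq) cK cn.
exists `|phi c| => // p; have [Kp|Kp] := pselect (K p).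
  by apply: cmax; rewrite inE.
by rewrite phi0// normr0.
Qed.

Lemma test_functionD phi psi : test_function phi -> test_function psi ->
  test_function (fun p => phi p + psi p).
Proof.
move=> tf tg; have [K [cK phi0]] := test_functionE tf.
have [L [cL psi0]] := test_functionE tg.
apply: (@test_functionI _ (K `|` L)); first 1 last.
- exact: compactU.
- by move=> p /not_orP[/phi0 -> /psi0 ->]; rewrite addr0.
- by move=> k; apply: CkD; [exact: tf.1|exact: tg.1].
Qed.

Lemma test_functionZ (c : R) phi : test_function phi ->
  test_function (fun p => c * phi p).
Proof.
move=> tf; have [K [cK phi0]] := test_functionE tf.
apply: (test_functionI _ cK) => [k|p /phi0 ->]; last by rewrite mulr0.
by apply: CkM; [exact: Ck_cst|exact: tf.1].
Qed.

Lemma test_function_sqr phi : test_function phi ->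
  test_function (fun p => phi p * phi p).
Proof.
move=> tf; have [K [cK phi0]] := test_functionE tf.
apply: (test_functionI _ cK) => [k|p /phi0 ->]; last by rewrite mulr0.
by apply: CkM; exact: tf.1.
Qed.

Lemma test_function_shift phi (a : 'rV[R]_n) : test_function phi ->
  test_function (fun p => phi (p + a)).
Proof.
move=> tf; have [K [cK phi0]] := test_functionE tf.
have cs (b : 'rV[R]_n) : continuous (fun p : 'rV[R]_n => p + b).
  by move=> p; apply: (@continuousD _ _ _ id (cst b));
    [exact: cvg_id|exact: cst_continuous].
apply: (@test_functionI _ ((fun p : 'rV[R]_n => p - a) @` K)).
- move=> k; apply: (@Ck_affine _ k _ _ _ phi (fun p : 'rV[R]_n => p + a) id (cs a)).
    by move=> h v x; rewrite addrA.
  exact: tf.1.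
- by apply: continuous_compact cK; apply: continuous_subspaceT; exact: cs.
- move=> p Kp; apply: phi0 => Kpa; apply: Kp; exists (p + a) => //.
  by rewrite addrK.
Qed.

Lemma test_function_sum (I : Type) (r : seq I) (f : I -> 'rV[R]_n -> R) :
  (forall i, test_function (f i)) ->
  test_function (fun p => \sum_(i <- r) f i p).
Proof.
move=> tf; elim: r => [|i r IH].
  under eq_fun do rewrite big_nil.
  by apply: (@test_functionI _ set0) => //; [move=> k; exact: Ck_cst|exact: compact0].
by under eq_fun do rewrite big_cons; exact: test_functionD.
Qed.

(** Finitely many translates of the square of [phi] are jointly positive on the
    support of [phi], so that a multiple of their sum dominates [phi]. *)
Lemma test_function_dominated phi : test_function phi ->
  exists2 chi, test_function chi & forall p, `|phi p| <= chi p.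
Proof.
move=> tf; have [[p0 phip0]|phi0] := pselect (exists p, phi p <> 0); last first.
  exists phi => // p; suff -> : phi p = 0 by rewrite normr0.
  by apply: contrapT => ?; apply: phi0; exists p.
have [K [cK phiK]] := test_functionE tf.
have [M M0 phiM] := test_function_bounded tf.
(* Half of the value of the square at [p0], so as to get a strict inequality on
   a neighbourhood of each point. *)
pose c := phi p0 ^+ 2 / 2.
have c0 : 0 < c by rewrite divr_gt0// exprn_even_gt0//; apply/eqP.
pose sq (q p : 'rV[R]_n) := phi (p + (p0 - q)) * phi (p + (p0 - q)).
have tsq q : test_function (sq q).
  exact: (test_function_shift (p0 - q) (test_function_sqr tf)).
have osq q : open [set p | c < sq q p].
  apply: (@open_comp _ _ (sq q) [set x | c < x]); last exact: open_gt.
  by move=> p _; exact: test_function_continuous.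
have := cK; rewrite compact_cover => /(_ _ setT (fun q => [set p | c < sq q p])).
case=> [q _|q Kq|D _ KD].
- exact: osq.
- exists q => //=; rewrite /sq addrC subrK -expr2 /c.
  by rewrite ltr_pdivrMr// mulrDr mulr1 ltrDl exprn_even_gt0//; apply/eqP.
exists (fun p => (M / c) * \sum_(q <- finmap.enum_fset D) sq q p).
  by apply: test_functionZ; exact: test_function_sum.
have Mc : 0 <= M / c by rewrite divr_ge0// ltW.
have sq_ge0 q p : 0 <= sq q p by rewrite /sq -expr2 sqr_ge0.
move=> p; have [Kp|Kp] := pselect (K p); last first.
  by rewrite phiK// normr0 mulr_ge0 ?sumr_ge0.
have [q qD cq] := KD p Kp.
apply: (le_trans (phiM p)).
rewrite -{1}(divfK (lt0r_neq0 c0) M) ler_wpM2l//.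
rewrite (big_rem q)//=; apply: (le_trans (ltW cq)).
by rewrite lerDl sumr_ge0.
Qed.

End test_functions.

(** * Left invariant vector fields *)

Section left_invariant_fields.
Variables (R : realType) (n : nat) (G : carnotGroup R n).
Implicit Types (phi psi : 'rV[R]_n -> R) (u v w p : 'rV[R]_n).
Local Notation mul := (carnot_mul G).
Local Notation br := (carnot_bracket G).
Local Notation L := (vfield G).

Lemma carnot_mul_continuous : continuous (fun pq : 'rV[R]_n * 'rV[R]_n => mul pq.1 pq.2).
Proof. exact: (Ck_continuous (carnot_smooth G 0%N)). Qed.

Lemma pull_smooth phi : smooth phi ->
  smooth (fun pq : 'rV[R]_n * 'rV[R]_n => phi (mul pq.1 pq.2)).
Proof. by move=> sphi k; exact: (Ck_comp (sphi k) (carnot_smooth G k)). Qed.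

Lemma pair_continuousl v : continuous (fun p : 'rV[R]_n => (p, v)).
Proof. by move=> p; exact: (cvg_pair cvg_id (@cst_continuous _ _ v p)). Qed.

Lemma pair_continuousr p : continuous (fun v : 'rV[R]_n => (p, v)).
Proof. by move=> v; exact: (cvg_pair (@cst_continuous _ _ p v) cvg_id). Qed.

Lemma right_mul_smooth phi v : smooth phi -> smooth (fun p => phi (mul p v)).
Proof.
move=> sphi k; apply: (Ck_affine (L := fun u => (u, 0)) (@pair_continuousl v) _
  (pull_smooth sphi k)) => h u p.
by apply/pair_equal_spec; split; rewrite //= scaler0 add0r.
Qed.

Lemma left_mul_smooth phi p : smooth phi -> smooth (fun v => phi (mul p v)).
Proof.
move=> sphi k; apply: (Ck_affine (L := fun u => (0, u)) (@pair_continuousr p) _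
  (pull_smooth sphi k)) => h u v.
by apply/pair_equal_spec; split; rewrite //= scaler0 add0r.
Qed.

Lemma vfieldE v phi p : L v phi p = 'D_v (fun q => phi (mul p q)) 0.
Proof.
rewrite /vfield /left_field derive1E; apply: eq_derive => h.
by rewrite [h *: 1]mulr1 !addr0.
Qed.

(** [vfield G v phi] is a directional derivative of the function
    [(p, q) |-> phi (p q)], restricted to [q = 0]. *)
Lemma vfield_smooth v phi : smooth phi -> smooth (L v phi).
Proof.
move=> sphi k.
pose F (pq : 'rV[R]_n * 'rV[R]_n) := phi (mul pq.1 pq.2).
have [_ /(_ (0, v))[_ sF]] := pull_smooth sphi k.+1.
rewrite [X in Ck k X](_ : _ = 'D_(0, v) F \o (fun p => (p, 0))).
  apply: (Ck_affine (L := fun u => (u, 0)) (@pair_continuousl 0) _ sF) => h u p.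
  by apply/pair_equal_spec; split; rewrite //= scaler0 add0r.
apply/funext => p; rewrite vfieldE; apply: eq_derive => h.
by rewrite /F /= scaler0 add0r.
Qed.

Lemma vfield_addl u v phi p : smooth phi -> L (u + v) phi p = L u phi p + L v phi p.
Proof. by move=> sphi; rewrite !vfieldE; exact/derive_dirD/left_mul_smooth. Qed.

Lemma vfield_scalel (c : R) v phi p : smooth phi -> L (c *: v) phi p = c * L v phi p.
Proof. by move=> sphi; rewrite !vfieldE; exact/derive_dirZ/left_mul_smooth. Qed.

Lemma vfield_derivable v phi p : smooth phi ->
  derivable (fun q => phi (mul p q)) 0 v.
Proof. by move=> /(left_mul_smooth p)/(_ 1%N)[_ /(_ v)[]]. Qed.

Lemma vfieldD v phi psi p : smooth phi -> smooth psi ->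
  L v (fun q => phi q + psi q) p = L v phi p + L v psi p.
Proof. by move=> sf sg; rewrite !vfieldE; apply: deriveD; exact: vfield_derivable. Qed.

Lemma vfieldZ v (c : R) phi p : smooth phi ->
  L v (fun q => c * phi q) p = c * L v phi p.
Proof. by move=> sf; rewrite !vfieldE; apply: deriveZ; exact: vfield_derivable. Qed.

Lemma vfieldB v phi psi p : smooth phi -> smooth psi ->
  L v (fun q => phi q - psi q) p = L v phi p - L v psi p.
Proof. by move=> sf sg; rewrite !vfieldE; apply: deriveB; exact: vfield_derivable. Qed.

Lemma vfield_br u v phi p : smooth phi ->
  L (br u v) phi p = L u (L v phi) p - L v (L u phi) p.
Proof. by move=> sphi; exact: carnot_bracketE. Qed.

(** The derivatives of the coordinate functions at the identity are the
    coordinates of the direction. Thus the algebraic properties of the bracket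
    are inherited from those of commutators of operators. *)
Lemma vfield_inj u v :
  (forall phi p, smooth phi -> L u phi p = L v phi p) -> u = v.
Proof.
move=> uv; apply/rowP => i.
pose coo (q : 'rV[R]_n) := q 0 i.
have scoo : smooth coo.
  move=> k; apply: (Ck_coord (g := id)).
  case: k => [|k]; first by split=> //; by move=> x; exact: cvg_id.
  split=> [|w]; first by move=> x; exact: cvg_id.
  split=> [x|]; first exact: derivable_id.
  rewrite [X in Ck k X](_ : _ = fun=> w); first exact: Ck_cst.
  by apply/funext => x; exact: derive_id.
have cooE w : L w coo 0 = w 0 i.
  rewrite vfieldE [X in 'D_w X _](_ : _ = fun q : 'rV[R]_n => q 0 i); last first.
    by apply/funext => q; rewrite carnot_mul0p.
  by have := derive_mx (@derivable_id _ _ (0 : 'rV[R]_n) w);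
    rewrite derive_id => /matrixP/(_ 0 i); rewrite mxE.
by rewrite -!cooE; exact: uv.
Qed.

Lemma brC u v : br u v = - br v u.
Proof.
apply: vfield_inj => phi p sphi.
by rewrite -scaleN1r vfield_scalel// !vfield_br// mulN1r opprB.
Qed.

Lemma br_addr u v w : br u (v + w) = br u v + br u w.
Proof.
apply: vfield_inj => phi p sphi; rewrite vfield_addl// !vfield_br//.
have -> : L (v + w) phi = fun q => L v phi q + L w phi q.
  by apply/funext => q; exact: vfield_addl.
rewrite vfieldD; [|exact: vfield_smooth..].
have sL : smooth (L u phi) by exact: vfield_smooth.
by rewrite (vfield_addl v w p sL) opprD addrACA.
Qed.

Lemma br_scaler (c : R) u v : br u (c *: v) = c *: br u v.
Proof.
apply: vfield_inj => phi p sphi; rewrite vfield_scalel// !vfield_br//.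
have -> : L (c *: v) phi = fun q => c * L v phi q.
  by apply/funext => q; exact: vfield_scalel.
rewrite vfieldZ; last exact: vfield_smooth.
have sL : smooth (L u phi) by exact: vfield_smooth.
by rewrite (vfield_scalel c v p sL) mulrBr.
Qed.

Lemma br_addl u v w : br (u + v) w = br u w + br v w.
Proof. by rewrite brC br_addr opprD -!brC. Qed.

Lemma br_scalel (c : R) u v : br (c *: u) v = c *: br u v.
Proof. by rewrite brC br_scaler -scalerN -brC. Qed.

Lemma br_jacobi u v w : br u (br v w) = br (br u v) w + br v (br u w).
Proof.
apply: vfield_inj => phi p sphi.
have brE a b : L (br a b) phi = fun q => L a (L b phi) q - L b (L a phi) q.
  by apply/funext => q; exact: vfield_br.
have sX a psi : smooth psi -> smooth (L a psi) by exact: vfield_smooth.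
rewrite (vfield_addl _ _ _ sphi) !(vfield_br _ _ _ sphi) !brE.
rewrite !(vfieldB _ _ (sX _ _ (sX _ _ sphi)) (sX _ _ (sX _ _ sphi))).
rewrite !(vfield_br _ _ _ (sX _ _ sphi)).
have aux (a b c d e f : R) :
  a - b - (c - d) = a - e - (f - d) + (e - c - (b - f)) by ring.
exact: aux.
Qed.

Lemma right_mulK (s : R) v p : mul (mul p (s *: v)) ((- s) *: v) = p.
Proof. by rewrite -carnot_mulA carnot_exp subrr scale0r carnot_mulp0. Qed.

Lemma right_mul_continuous v : continuous (fun p => mul p v).
Proof.
move=> p; apply: (@continuous_comp _ _ _ (fun p => (p, v))
  (fun pq : 'rV[R]_n * 'rV[R]_n => mul pq.1 pq.2)).
- exact: pair_continuousl.
- exact: carnot_mul_continuous.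
Qed.

Lemma test_function_right_mul v phi : test_function phi ->
  test_function (fun p => phi (mul p v)).
Proof.
move=> tphi; have [K [cK phi0]] := test_functionE tphi.
apply: (@test_functionI _ _ _ ((fun p => mul p (- v)) @` K)).
- exact: (right_mul_smooth v tphi.1).
- apply: continuous_compact cK; apply: continuous_subspaceT.
  exact: right_mul_continuous.
- move=> p Kp; apply: phi0 => Kpv; apply: Kp; exists (mul p v) => //.
  by have := right_mulK 1 v p; rewrite scale1r scaleN1r.
Qed.

Lemma vfield_support v phi (K : set 'rV[R]_n) : compact K ->
  (forall p, ~ K p -> phi p = 0) -> forall p, ~ K p -> L v phi p = 0.
Proof.
move=> cK phi0 p Kp; rewrite vfieldE -[RHS](derive_cst (0 : R) (0 : 'rV[R]_n) v).
apply: near_eq_derive.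
have oK : open (~` K) by apply: closed_openC; exact: rV_compact_closed.
have cm : {for (0 : 'rV[R]_n), continuous (fun q => mul p q)}.
  apply: (@continuous_comp _ _ _ (fun v => (p, v))
    (fun pq : 'rV[R]_n * 'rV[R]_n => mul pq.1 pq.2)).
  - exact: pair_continuousr.
  - exact: carnot_mul_continuous.
have : nbhs (mul p 0) (~` K) by rewrite carnot_mulp0; exact: open_nbhs_nbhs.
move=> /cm KK; near=> q; apply: phi0.
by near: q; exact: KK.
Unshelve. all: by end_near.
Qed.

Lemma vfield_test v phi : test_function phi -> test_function (L v phi).
Proof.
move=> tphi; have [K [cK phi0]] := test_functionE tphi.
apply: (test_functionI _ cK); first by apply: vfield_smooth; exact: tphi.1.
exact: vfield_support.
Qed.

(** The translation is by an element of the one-parameter subgroup that defines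
    [vfield G v], and this subgroup is commutative. *)
Lemma vfield_right_mul v (t : R) phi :
  L v (fun p => phi (mul p (t *: v))) = fun p => L v phi (mul p (t *: v)).
Proof.
apply/funext => p; rewrite /vfield /left_field; congr (derive1 _ 0).
by apply/funext => s; rewrite -!carnot_mulA !carnot_exp addrC.
Qed.

Lemma is_derive_flow v phi p (t : R) : smooth phi ->
  is_derive t 1 (fun s : R => phi (mul p (s *: v))) (L v phi (mul p (t *: v))).
Proof.
move=> sphi.
have e h : phi (mul p ((h *: 1 + t) *: v)) = phi (mul (mul p (t *: v)) (h *: v + 0)).
  by rewrite addr0 -carnot_mulA carnot_exp [h *: 1]mulr1 [h + t]addrC.
apply: DeriveDef; last by rewrite vfieldE; exact: eq_derive.
have d := @vfield_derivable v phi (mul p (t *: v)) sphi.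
exact: (@eq_derivable R _ _ _ (fun s : R => phi (mul p (s *: v)))
  (fun q => phi (mul (mul p (t *: v)) q)) t 1 0 v e d).
Qed.

End left_invariant_fields.

(** * Integrability of test functions *)

Section integration.
Variables (R : realType) (n : nat).
Implicit Types (phi psi : 'rV[R]_n -> R) (K : set 'rV[R]_n).

Lemma continuous_measurable_rV phi : continuous phi ->
  measurable_fun setT (phi : 'rV[R]_n -> measurableTypeR R).
Proof.
move=> cphi; apply: (measurability _ (measurable_realfun.RGenOpens.measurableE R)).
move=> _ [_ [a [b ->] <-]]; rewrite setTI; apply: sub_sigma_algebra.
by apply: open_comp; [move=> p _; exact: cphi|exact: interval_open].
Qed.

Lemma compact_measurable_rV K : compact K -> measurable K.
Proof.
move=> /rV_compact_closed cK; rewrite -[K]setCK; apply: measurableC.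
by apply: sub_sigma_algebra; exact: closed_openC.
Qed.

Lemma integrable_finite_support d (T : measurableType d)
    (mu : {measure set T -> \bar R}) (K : set T) (f : T -> R) (M : R) :
  measurable K -> (mu K < +oo)%E -> measurable_fun setT f ->
  (forall x, `|f x| <= M) -> (forall x, ~ K x -> f x = 0) ->
  mu.-integrable setT (EFin \o f).
Proof.
move=> mK Koo mf fM f0.
have -> : EFin \o f = (EFin \o f) \_ K.
  apply/funext => x; rewrite patchE; case: ifPn => //.
  by rewrite notin_setE => /f0 /= ->.
apply/(integrable_mkcond _ mK)/measurable_bounded_integrable => //.
  exact: measurable_funTS.
by exists M; split; [exact: num_real|move=> N MN x _; exact: le_trans (fM x) (ltW MN)].
Qed.

Lemma radon_integrable (mu : {measure set 'rV[R]_n -> \bar R}) phi :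
  radon mu -> test_function phi -> mu.-integrable setT (EFin \o phi).
Proof.
move=> rmu tphi; have [K [cK phi0]] := test_functionE tphi.
have [M _ phiM] := test_function_bounded tphi.
apply: (@integrable_finite_support _ _ _ K _ M) => //.
- exact: compact_measurable_rV.
- exact: rmu.
- by apply: continuous_measurable_rV; exact: test_function_continuous.
Qed.

Lemma lebesgueV_compact K : compact K -> (lebesgueV R n K < +oo)%E.
Proof.
move=> cK; have [M [_ /(_ (M + 1))]] := compact_bounded cK.
rewrite ltrDl ltr01 => /(_ isT) KM.
pose A (i : 'I_n) : set R := `[- (M + 1), M + 1]%classic.
pose B := [set v : 'rV[R]_n | forall i, A i (v 0 i)].
have KB : K `<=` B.
  move=> p Kp i; rewrite /A /= in_itv /= -ler_norml.
  apply: le_trans (KM p Kp).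
  rewrite /Num.Def.normr /= mx_normrE.
  exact: (le_bigmax _ (fun j : 'I_1 * 'I_n => `|p j.1 j.2|) (0, i)).
have mB : measurable B.
  have -> : B = \bigcap_(i in [set: 'I_n])
      ((fun v : 'rV[R]_n => v 0 i : measurableTypeR R) @^-1` A i).
    by apply/seteqP; split=> v h i; [move=> _; exact: h|exact: (h i)].
  apply: fin_bigcap_measurable => [|i _]; first exact: finite_finset.
  rewrite -[X in measurable X]setTI; apply: (coord_measurable i) => //.
  exact: measurable_itv.
have BE : lebesgueV R n B = lebesgue_rV R n B.
  exact: measurable_mu_extE.
apply: (@le_lt_trans _ _ (lebesgueV R n B)).
  apply: le_measure => //; rewrite inE; apply: sub_caratheodory;
    apply: sub_sigma_algebra => //; exact: compact_measurable_rV.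
rewrite BE lebesgue_rV_box; last by move=> i; exact: measurable_itv.
suff /andP[] : (0 <= \prod_(i < n) lebesgue_measure (A i) < +oo)%E by [].
elim/big_ind : _ => [|x y /andP[x0 xoo] /andP[y0 yoo]|i _].
- by rewrite lee01 ltry.
- by rewrite mule_ge0//= lte_mul_pinfty// ge0_fin_numE.
- rewrite measure_ge0 /=.
  by rewrite lebesgue_measure_itv /=; case: ifP => _; exact: ltry.
Qed.

Lemma lebesgueV_integrable E phi : lebesgue_measurable E -> test_function phi ->
  (lebesgueV R n).-integrable E (EFin \o phi).
Proof.
move=> mE tphi; have [K [cK phi0]] := test_functionE tphi.
have [M _ phiM] := test_function_bounded tphi.
have cara (A : set 'rV[R]_n) : measurable A -> lebesgue_measurable A.
  by move=> mA; apply: sub_caratheodory; exact: sub_sigma_algebra.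
apply: (@integrableS _ (lebesgueTypeV R n) R (lebesgueV R n) setT) => //.
apply: (@integrable_finite_support _ (lebesgueTypeV R n) _ K phi M) => //.
- exact: (cara _ (compact_measurable_rV cK)).
- exact: lebesgueV_compact.
- move=> _ Y mY; apply: cara.
  exact: (continuous_measurable_rV (test_function_continuous tphi) measurableT mY).
Qed.

End integration.

(** * Invariant directions *)

Section invariant_directions.
Variables (R : realType) (n : nat) (G : carnotGroup R n).
Implicit Types (phi psi : 'rV[R]_n -> R) (u v w p : 'rV[R]_n) (E : set 'rV[R]_n).
Local Notation mul := (carnot_mul G).
Local Notation br := (carnot_bracket G).
Local Notation L := (vfield G).

Section fixed_set.
Variables (E : set 'rV[R]_n).
Hypothesis mE : lebesgue_measurable E.

Lemma DindB v phi psi : test_function phi -> test_function psi ->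
  Dind G E v (fun p => phi p - psi p) = Dind G E v phi - Dind G E v psi.
Proof.
move=> tf tg; rewrite /Dind -opprD; congr (- _).
have -> : L v (fun p => phi p - psi p) = fun p => L v phi p - L v psi p.
  by apply/funext => p; apply: vfieldB; [exact: tf.1|exact: tg.1].
by apply: (@RintegralB _ (lebesgueTypeV R n)) => //;
  apply: lebesgueV_integrable => //; exact: vfield_test.
Qed.

Lemma Dind_addl u v phi : test_function phi ->
  Dind G E (u + v) phi = Dind G E u phi + Dind G E v phi.
Proof.
move=> tf; rewrite /Dind -opprD; congr (- _).
have -> : L (u + v) phi = fun p => L u phi p + L v phi p.
  by apply/funext => p; apply: vfield_addl; exact: tf.1.
by apply: (@RintegralD _ (lebesgueTypeV R n)) => //;
  apply: lebesgueV_integrable => //; exact: vfield_test.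
Qed.

Lemma Dind_scalel (c : R) v phi : test_function phi ->
  Dind G E (c *: v) phi = c * Dind G E v phi.
Proof.
move=> tf; rewrite /Dind mulrN; congr (- _).
have -> : L (c *: v) phi = fun p => c * L v phi p.
  by apply/funext => p; apply: vfield_scalel; exact: tf.1.
by apply: (@RintegralZl _ (lebesgueTypeV R n)) => //;
  apply: lebesgueV_integrable => //; exact: vfield_test.
Qed.

Lemma Dind_br u v phi : test_function phi ->
  Dind G E (br u v) phi = Dind G E u (L v phi) - Dind G E v (L u phi).
Proof.
move=> tf; rewrite /Dind -opprD; congr (- _).
have -> : L (br u v) phi = fun p => L u (L v phi) p - L v (L u phi) p.
  by apply/funext => p; apply: vfield_br; exact: tf.1.
by apply: (@RintegralB _ (lebesgueTypeV R n)) => //;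
  apply: lebesgueV_integrable => //; apply: vfield_test; exact: vfield_test.
Qed.

Lemma Dind_eq0_add u v : Dind_eq0 G E u -> Dind_eq0 G E v -> Dind_eq0 G E (u + v).
Proof. by move=> u0 v0 phi tf; rewrite Dind_addl// u0// v0// addr0. Qed.

Lemma Dind_eq0_scale (c : R) v : Dind_eq0 G E v -> Dind_eq0 G E (c *: v).
Proof. by move=> v0 phi tf; rewrite Dind_scalel// v0// mulr0. Qed.

Lemma Dind_eq0_br u v : Dind_eq0 G E u -> Dind_eq0 G E v -> Dind_eq0 G E (br u v).
Proof.
by move=> u0 v0 phi tf; rewrite Dind_br// u0 ?v0 ?subrr//; exact: vfield_test.
Qed.

(** A test function [phi] dominated by [chi] is the difference of the
    nonnegative test functions [chi] and [chi - phi]. *)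
Lemma Dind_eq0_nonneg v :
  (forall phi, test_function phi -> (forall p, 0 <= phi p) -> Dind G E v phi = 0) ->
  Dind_eq0 G E v.
Proof.
move=> v0 phi tf; have [chi tchi phichi] := test_function_dominated tf.
have tN : test_function (fun p => chi p - phi p).
  have := test_functionD tchi (test_functionZ (-1) tf).
  by under eq_fun do rewrite mulN1r.
have -> : phi = fun p => chi p - (chi p - phi p).
  by apply/funext => p; rewrite opprB addrC subrK.
rewrite DindB// !v0 ?subrr// => p.
- by rewrite subr_ge0 (le_trans (ler_norm _) (phichi p)).
- exact: le_trans (normr_ge0 _) (phichi p).
Qed.

End fixed_set.

(** The domination needed under the integral sign comes from the compact set
    swept by the support of [phi] at the times at distance at most [1] from [t]. *)
Lemma is_derive_radon (mu : {measure set 'rV[R]_n -> \bar R}) v phi (t : R) :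
  radon mu -> test_function phi ->
  is_derive t 1 (fun s : R => \int[mu]_p phi (mul p (s *: v)))
    (\int[mu]_p L v phi (mul p (t *: v))).
Proof.
move=> rmu tf; have [K [cK phi0]] := test_functionE tf.
have tL := vfield_test G v tf.
have [M M0 phiM] := test_function_bounded tL.
(* The points that the flow moves into [K] at time [s] are obtained by flowing
   back from [K] for the time [- s]. *)
pose back (qs : 'rV[R]_n * R) := mul qs.1 (qs.2 *: v).
have c2 : continuous (fun qs : 'rV[R]_n * R => qs.2 *: v).
  move=> qs; apply: (@continuous_comp _ _ _ snd (fun s : R => s *: v)).
    exact: cvg_snd.
  exact: scalel_continuous.
have cback : continuous back.
  move=> qs; apply: (@continuous_comp _ _ _ (fun qs : 'rV[R]_n * R =>
    (qs.1, qs.2 *: v)) (fun pq : 'rV[R]_n * 'rV[R]_n => mul pq.1 pq.2)).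
    exact: (@cvg_pair _ _ _ (nbhs qs) (nbhs qs.1) (nbhs (qs.2 *: v)) _ _ _ fst
      (fun qs => qs.2 *: v) cvg_fst (c2 qs)).
  exact: carnot_mul_continuous.
pose K' := back @` (K `*` `[- t - 1, - t + 1]%classic).
have cK' : compact K'.
  apply: continuous_compact; first exact: continuous_subspaceT.
  by apply: compact_setX => //; exact: segment_compact.
pose f (s : R) p := phi (mul p (s *: v)).
have df s p := is_derive_flow G v p s tf.1.
have d1f s p : partial1of2 f s p = L v phi (mul p (s *: v)).
  by rewrite partial1of2E; case: (df s p).
have tI : `]t - 1, t + 1[%classic t.
  by rewrite /= in_itv /= ltrBlDr ltrDl ltr01.
have If s : `]t - 1, t + 1[%classic s -> mu.-integrable setT (EFin \o f s).
  by move=> _; apply: radon_integrable => //; exact: test_function_right_mul.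
have Df s p : `]t - 1, t + 1[%classic s -> setT p -> derivable (f ^~ p) s 1.
  by move=> _ _; case: (df s p).
pose g p := M * \1_K' p.
have g0 p : 0 <= g p by rewrite mulr_ge0.
have Ig : mu.-integrable setT (EFin \o g).
  have mK' := compact_measurable_rV cK'.
  apply: (@integrable_finite_support _ _ _ _ K' _ M) => //.
  - exact: rmu.
  - by apply: measurable_realfun.measurable_funM => //; exact: measurable_indic.
  - move=> p; rewrite ger0_norm// /g indicE.
    by case: (p \in K'); rewrite ?mulr1 ?mulr0.
  - by move=> p pK; rewrite /g indicE memNset// mulr0.
have gf s p : `]t - 1, t + 1[%classic s -> setT p -> `|partial1of2 f s p| <= g p.
  rewrite /= in_itv /= => /andP[s1 s2] _; rewrite d1f /g indicE.
  have [pK|pK] := pselect (K' p); first by rewrite mem_set// mulr1.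
  rewrite memNset// mulr0 (@vfield_support R n G v phi K cK phi0) ?normr0// => Kp.
  apply: pK; exists (mul p (s *: v), - s); last exact: right_mulK.
  by split=> //=; rewrite in_itv /=; apply/andP; split; lra.
have mT : measurable [set: 'rV[R]_n] := measurableT.
apply: DeriveDef.
  exact: (derivable_under_integral mT tI If Df g0 Ig gf).
rewrite -derive1E (differentiation_under_integral mT tI If Df g0 Ig gf).
by apply: eq_Rintegral => p _; exact: d1f.
Qed.

(** Representing [Dind G E u] by measures lets the derivative in time fall on the
    test function alone. *)
Lemma is_derive_Dind E u v phi (t : R) mup mum :
  Dind_is_measure G E u mup mum -> test_function phi ->
  is_derive t 1 (fun s : R => Dind G E u (fun p => phi (mul p (s *: v))))
    (Dind G E u (L v (fun p => phi (mul p (t *: v))))).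
Proof.
move=> [rp rm uE] tf.
have tt s psi : test_function psi -> test_function (fun p => psi (mul p (s *: v))).
  exact: test_function_right_mul.
rewrite vfield_right_mul uE; last by apply: tt; exact: vfield_test.
rewrite [X in is_derive _ _ X _](_ : _ =
  (fun s : R => \int[mup]_p phi (mul p (s *: v))) -
  (fun s : R => \int[mum]_p phi (mul p (s *: v)))); last first.
  by apply/funext => s; rewrite uE//; exact: tt.
have d1 := is_derive_radon v t rp tf; have d2 := is_derive_radon v t rm tf.
exact: is_deriveB.
Qed.

Lemma is_derive_cst_affine (g : R -> R) (a : R) :
  (forall t : R, is_derive t 1 g a) -> forall t, g t = g 0 + a * t.
Proof.
move=> dg t.
have dgt s : derivable g s t /\ 'D_t g s = t * a.
  have [d1 e1] := dg s; have := derivable_scale t d1.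
  by rewrite e1 [t *: 1]mulr1.
have [s _] := mean_value 0 (fun s => (dgt s).1).
by rewrite add0r (dgt _).2 [t * a]mulrC => /eqP; rewrite subr_eq addrC => /eqP.
Qed.

Lemma affine_signed_slope (g : R -> R) (a : R) :
  (forall t : R, is_derive t 1 g a) ->
  (forall t, 0 <= g t) \/ (forall t, g t <= 0) -> a = 0.
Proof.
move=> /is_derive_cst_affine gE sg; apply/eqP/negP => /negP a0.
by case: sg => sg; [have := sg ((- g 0 - 1) / a)|have := sg ((- g 0 + 1) / a)];
  rewrite gE mulrCA divff// mulr1; lra.
Qed.

(** On the translates of [phi] along the flow of [v], [Dind G E u] is an affine
    function of the time: up to the sign, its slope is the value of
    [Dind G E (br v u)], whose own derivative is a value of
    [Dind G E (br v (br v u))]. For a nonnegative [phi] it has a constant sign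
    over the whole real line, so that the slope vanishes. *)
Lemma Dind_bracket_eq0 E u v : lebesgue_measurable E ->
  (exists mup mum, Dind_is_measure G E u mup mum) ->
  (forall phi, test_function phi -> (forall p, 0 <= phi p) -> 0 <= Dind G E u phi) \/
  (forall phi, test_function phi -> (forall p, 0 <= phi p) -> Dind G E u phi <= 0) ->
  Dind_eq0 G E v -> br v (br v u) = 0 -> Dind_eq0 G E (br v u).
Proof.
move=> mE [mup [mum uE]] su v0 vvu; apply: Dind_eq0_nonneg => // phi tf phi_ge0.
pose tr psi (t : R) p := psi (mul p (t *: v)).
have tt psi t : test_function psi -> test_function (tr psi t).
  exact: test_function_right_mul.
have dg psi (t : R) : test_function psi -> is_derive t 1 (fun s => Dind G E u (tr psi s))
    (- Dind G E (br v u) (tr psi t)).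
  move=> tpsi; rewrite Dind_br//; last exact: tt.
  rewrite [Dind G E v _]v0; last by apply: vfield_test; exact: tt.
  by rewrite sub0r opprK; exact: (is_derive_Dind v t uE tpsi).
have L0 t psi : test_function psi -> Dind G E (br v u) (L v (tr psi t)) = 0.
  move=> tpsi.
  have : Dind G E (br v (br v u)) (tr psi t) = 0.
    rewrite vvu -(scale0r u) Dind_scalel ?mul0r//; exact: tt.
  rewrite (Dind_br mE _ _ (tt _ t tpsi)) (v0 _ (vfield_test G _ (tt _ t tpsi))).
  by rewrite sub0r => /eqP; rewrite oppr_eq0 => /eqP.
have constant_slope t : Dind G E (br v u) (tr phi t) = Dind G E (br v u) phi.
  have gE psi s : test_function psi ->
      Dind G E u (tr (L v psi) s) = - Dind G E (br v u) (tr psi s).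
    move=> tpsi; rewrite Dind_br//; last exact: tt.
    rewrite [Dind G E v _]v0; last by apply: vfield_test; exact: tt.
    by rewrite sub0r opprK /tr vfield_right_mul.
  have dg0 (s : R) : is_derive s 1 (fun s => Dind G E u (tr (L v phi) s)) 0.
    have := dg _ s (vfield_test G v tf).
    by rewrite /tr -vfield_right_mul L0// oppr0.
  have e : Dind G E u (tr (L v phi) t) = Dind G E u (tr (L v phi) 0).
    by have := is_derive_cst_affine dg0 t; rewrite mul0r addr0.
  have tr0 : tr phi 0 = phi by apply/funext => p; rewrite /tr scale0r carnot_mulp0.
  by move: e; rewrite (gE phi t tf) (gE phi 0 tf) tr0 => /oppr_inj.
apply/eqP; rewrite -oppr_eq0; apply/eqP.
apply: (@affine_signed_slope (fun s => Dind G E u (tr phi s))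
  (- Dind G E (br v u) phi)) => [t|].
  by rewrite -(constant_slope t); exact: dg.
have tr_ge0 t p : 0 <= tr phi t p by exact: phi_ge0.
by case: su => su; [left|right] => t; apply: su => //; exact: tt.
Qed.

End invariant_directions.

(** * Lie algebras of type star *)

Section linear_predicates.
Variables (R : realType) (n : nat) (P : 'rV[R]_n -> Prop).
Hypothesis P0 : P 0.
Hypothesis PD : forall u v, P u -> P v -> P (u + v).
Hypothesis PZ : forall (c : R) u, P u -> P (c *: u).

Lemma span_ind (s : seq 'rV[R]_n) : (forall x, x \in s -> P x) ->
  forall x, x \in << s >>%VS -> P x.
Proof.
move=> Ps x; rewrite -[s]/(tval (in_tuple s)) => /coord_span ->.
elim/big_ind : _ => // i _; apply/PZ/Ps.
by rewrite /= mem_nth.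
Qed.

Lemma sum_layers_ind (V : nat -> {vspace 'rV[R]_n}) (a b : nat) :
  (forall k, (a <= k)%N -> forall x, x \in V k -> P x) ->
  forall x, x \in (\sum_(a <= k < b) V k)%VS -> P x.
Proof.
move=> PV; rewrite big_nat_cond.
elim/big_ind : _ => [x|U W PU PW x|k /andP[/andP[ak _] _]].
- by rewrite memv0 => /eqP ->.
- by case/memv_addP => u /PU Pu [w /PW Pw ->]; exact: PD.
- exact: PV.
Qed.

End linear_predicates.

Section layers.
Variables (R : realType) (n : nat) (G : carnotGroup R n).
Local Notation br := (carnot_bracket G).
Local Notation V := (layer G).

(** The linear span of the brackets is spanned by those of basis vectors, so a
    linear predicate can be checked on brackets. *)
Lemma layerS_ind (P : 'rV[R]_n -> Prop) (k : nat) : (0 < k)%N ->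
  P 0 -> (forall u v, P u -> P v -> P (u + v)) ->
  (forall (c : R) u, P u -> P (c *: u)) ->
  (forall x y, x \in V 1 -> y \in V k -> P (br x y)) ->
  forall z, z \in V k.+1 -> P z.
Proof.
move=> k0 P0 PD PZ Pbr z zV.
pose s := [seq br x y | x <- vbasis (V 1), y <- vbasis (V k)].
have [_ /(_ << s >>%VS) sub] := carnot_stratified G k0.
apply: (@span_ind _ _ P P0 PD PZ s) => [w /allpairsP[[x y] [/= xb yb ->]]|].
  by apply: Pbr; exact: vbasis_mem.
apply: (subvP (sub _)) zV => x y; rewrite -/(V 1) -/(V k).
rewrite -(span_basis (vbasisP (V 1))) -(span_basis (vbasisP (V k))) => xV yV.
apply: (@span_ind _ _ (fun x => br x y \in << s >>%VS) _ _ _ _ _ _ xV).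
- by rewrite -(scale0r (0 : 'rV[R]_n)) br_scalel scale0r mem0v.
- by move=> u v us vs; rewrite br_addl memvD.
- by move=> c u us; rewrite br_scalel memvZ.
- move=> {xV}x xb; apply: (@span_ind _ _ (fun y => br x y \in << s >>%VS) _ _ _ _ _ _ yV).
  + by rewrite -(scale0r (0 : 'rV[R]_n)) br_scaler scale0r mem0v.
  + by move=> u v us vs; rewrite br_addr memvD.
  + by move=> c u us; rewrite br_scaler memvZ.
  + by move=> {yV}y yb; apply: memv_span; apply: allpairs_f.
Qed.

Lemma layer_coord0 k x (i : 'I_n) : x \in V k -> carnot_weight G i != k -> x 0 i = 0.
Proof.
move=> xV ik; move: x xV; apply: span_ind => [|u v u0 v0|c u u0|x].
- by rewrite mxE.
- by rewrite mxE u0 v0 addr0.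
- by rewrite mxE u0 mulr0.
case/mapP => j; rewrite mem_filter => /andP[/eqP jk _] ->; rewrite mxE eqxx /=.
by case: (i =P j) => // ij; move: ik; rewrite ij jk eqxx.
Qed.

End layers.

Section star_algebra.
Variables (R : realType) (n : nat) (G : carnotGroup R n).
Local Notation br := (carnot_bracket G).
Local Notation V := (layer G).
Variables (l : 'rV[R]_n -> R) (Inv : 'rV[R]_n -> Prop).
Hypothesis lD : forall u v, l (u + v) = l u + l v.
Hypothesis lZ : forall (c : R) u, l (c *: u) = c * l u.
Hypothesis InvD : forall u v, Inv u -> Inv v -> Inv (u + v).
Hypothesis InvZ : forall (c : R) u, Inv u -> Inv (c *: u).
Hypothesis Invbr : forall u v, Inv u -> Inv v -> Inv (br u v).
Hypothesis Inv_ker : forall u, u \in V 1 -> l u = 0 -> Inv u.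
Hypothesis Inv_key : forall u w, u \in V 1 -> w \in V 1 -> l w = 0 ->
  br w (br w u) = 0 -> Inv (br w u).

Let l0 : l 0 = 0.
Proof. by rewrite -(scale0r (0 : 'rV[R]_n)) lZ mul0r. Qed.

Let Inv0 : Inv 0.
Proof. by apply: Inv_ker; [exact: mem0v|exact: l0]. Qed.

Let br0r u : br u 0 = 0.
Proof. by have := br_scaler G 0 u 0; rewrite !scale0r. Qed.

Let br0l u : br 0 u = 0.
Proof. by have := br_scalel G 0 0 u; rewrite !scale0r. Qed.

Let br_self u : br u u = 0.
Proof.
have /eqP := brC G u u; rewrite -subr_eq0 opprK -mulr2n -scaler_nat scaler_eq0.
by rewrite pnatr_eq0 /= => /eqP.
Qed.

Section star_basis.
Variable b : (\dim (V 1)).-tuple 'rV[R]_n.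
Hypothesis bV : basis_of (V 1) b.
Hypothesis star : forall i j, br (tnth b j) (br (tnth b j) (tnth b i)) = 0.

Let b1 i : tnth b i \in V 1.
Proof. by apply: (basis_mem bV); exact: mem_tnth. Qed.

Let b_ind (P : 'rV[R]_n -> Prop) : P 0 ->
  (forall u v, P u -> P v -> P (u + v)) -> (forall (c : R) u, P u -> P (c *: u)) ->
  (forall i, P (tnth b i)) -> forall x, x \in V 1 -> P x.
Proof.
move=> P0 PD PZ Pb x; rewrite -(span_basis bV); apply: span_ind => // y.
by case/tnthP => i ->.
Qed.

(** If neither [b_i] nor [b_j] lies in the kernel of [l], a combination [w] of
    them does, and [br w b_i] is a multiple of [br b_j b_i]. *)
Lemma Inv_star_br i j : Inv (br (tnth b i) (tnth b j)).
Proof.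
set x := tnth b i; set y := tnth b j.
have xx z : z \in [:: x; y] -> forall k, br z (br z (tnth b k)) = 0.
  by rewrite !inE => /orP[] /eqP -> k; exact: star.
have [lx|lx] := eqVneq (l x) 0; first by apply: Inv_key; rewrite ?star ?b1.
pose w := l y *: x - l x *: y.
have wx : br w x = - l x *: br y x.
  by rewrite /w br_addl -scaleNr !br_scalel br_self scaler0 add0r.
suff : Inv (br w x).
  rewrite wx brC => /(InvZ (l x)^-1).
  by rewrite scaleNr !scalerN opprK scalerA mulVf// scale1r.
apply: Inv_key.
- exact: b1.
- by rewrite memvB// memvZ// b1.
- by rewrite /w -scaleNr lD !lZ mulNr mulrC subrr.
- rewrite wx br_scaler /w br_addl -scaleNr !br_scalel [br x _](_ : _ = 0).
    by rewrite star !scaler0 addr0 scaler0.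
  by rewrite (brC _ y) -scaleN1r br_scaler star scaler0.
Qed.

Lemma Inv_br1 x y : x \in V 1 -> y \in V 1 -> Inv (br x y).
Proof.
move=> xV yV; move: x xV; apply: b_ind => [|u v|c u|i].
- by rewrite br0l.
- by rewrite br_addl; exact: InvD.
- by rewrite br_scalel; exact: InvZ.
move: y yV; apply: b_ind => [|u v|c u|j].
- by rewrite br0r.
- by rewrite br_addr; exact: InvD.
- by rewrite br_scaler; exact: InvZ.
exact: Inv_star_br.
Qed.

Section transverse.
Variable j : 'I_(\dim (V 1)).
Hypothesis lj : l (tnth b j) != 0.
Let X := tnth b j.

Let adX2 u : u \in V 1 -> br X (br X u) = 0.
Proof.
move: u; apply: b_ind => [|u v u0 v0|c u u0|i].
- by rewrite !br0r.
- by rewrite !br_addr u0 v0 addr0.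
- by rewrite !br_scaler u0 scaler0.
- exact: star.
Qed.

(** The Lie algebra generated by the kernel of [l] in the first layer and by
    its brackets with [X]. Being generated by elements which [ad X] sends to
    other such elements, or to zero, it is stable under [ad X]. *)
Inductive kernel_algebra : 'rV[R]_n -> Prop :=
| ka_ker u : u \in V 1 -> l u = 0 -> kernel_algebra u
| ka_adX u : u \in V 1 -> l u = 0 -> kernel_algebra (br X u)
| ka_add u v : kernel_algebra u -> kernel_algebra v -> kernel_algebra (u + v)
| ka_scale (c : R) u : kernel_algebra u -> kernel_algebra (c *: u)
| ka_br u v : kernel_algebra u -> kernel_algebra v -> kernel_algebra (br u v).

Lemma kernel_algebra_Inv u : kernel_algebra u -> Inv u.
Proof.
elim=> {u} [u uV lu|u uV lu|u v _ Iu _ Iv|c u _ Iu|u v _ Iu _ Iv].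
- exact: Inv_ker.
- by apply: Inv_br1 => //; exact: b1.
- exact: InvD.
- exact: InvZ.
- exact: Invbr.
Qed.

Let ka0 : kernel_algebra 0.
Proof. by apply: ka_ker; [exact: mem0v|exact: l0]. Qed.

Lemma kernel_algebra_adX u : kernel_algebra u -> kernel_algebra (br X u).
Proof.
elim=> {u} [u uV lu|u uV lu|u v _ Iu _ Iv|c u _ Iu|u v Ku Iu Kv Iv].
- exact: ka_adX.
- by rewrite adX2.
- by rewrite br_addr; exact: ka_add.
- by rewrite br_scaler; exact: ka_scale.
- by rewrite br_jacobi; apply: ka_add; exact: ka_br.
Qed.

Let decompose u : u \in V 1 -> exists (c : R) w,
  [/\ w \in V 1, l w = 0 & u = c *: X + w].
Proof.
move=> uV; exists (l u / l X), (u - (l u / l X) *: X); split.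
- by rewrite memvB// memvZ// b1.
- by rewrite -scaleNr lD lZ mulNr divfK// subrr.
- by rewrite addrC subrK.
Qed.

Lemma kernel_algebra_ad1 u x :
  u \in V 1 -> kernel_algebra x -> kernel_algebra (br u x).
Proof.
move=> /decompose[c [w [wV lw ->]]] Kx; rewrite br_addl br_scalel.
apply: ka_add; first exact/ka_scale/kernel_algebra_adX.
by apply: ka_br => //; exact: ka_ker.
Qed.

Lemma layer_kernel_algebra k x :
  (2 <= k)%N -> x \in V k -> kernel_algebra x.
Proof.
case: k => [|[|k]]// _.
elim: k x => [|k IH]; apply: layerS_ind => //; do ?[exact: ka_add|exact: ka_scale].
- move=> u y uV /decompose[c [w [wV lw ->]]]; rewrite br_addr br_scaler.
  apply: ka_add; last by apply: kernel_algebra_ad1 => //; exact: ka_ker.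
  apply: ka_scale; rewrite brC -scaleN1r; apply: ka_scale.
  move: uV => /decompose[c' [w' [wV' lw' ->]]].
  by rewrite br_addr br_scaler br_self scaler0 add0r; exact: ka_adX.
- by move=> u y uV /IH Ky; exact: kernel_algebra_ad1.
Qed.

End transverse.

Lemma Inv_layer_basis k x : (2 <= k)%N -> x \in V k -> Inv x.
Proof.
have [[j lj]|lb] := pselect (exists j, l (tnth b j) != 0).
  by move=> k2 xV; exact: (kernel_algebra_Inv (layer_kernel_algebra lj k2 xV)).
have l1 u : u \in V 1 -> Inv u.
  move=> uV; apply: Inv_ker => //; move: u uV; apply: b_ind => //.
  - by move=> u v u0 v0; rewrite lD u0 v0 addr0.
  - by move=> c u u0; rewrite lZ u0 mulr0.
  - by move=> i; apply/eqP/negP => /negP li; apply: lb; exists i.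
case: k => // k _; elim: k x => [|k IH] x; first exact: l1.
by apply: layerS_ind => // u y uV /IH Iy; apply: Invbr => //; exact: l1.
Qed.

End star_basis.

Lemma Inv_layer k x : type_star G -> (2 <= k)%N -> x \in V k -> Inv x.
Proof. by move=> [b [bV star]]; exact: (Inv_layer_basis bV star). Qed.

End star_algebra.

(** * Sets with a constant normal *)

Section constant_normal.
Variables (R : realType) (n : nat) (G : carnotGroup R n) (E : set 'rV[R]_n).
Implicit Types (phi : 'rV[R]_n -> R) (u v : 'rV[R]_n).
Hypothesis mE : lebesgue_measurable E.

Definition hdot v u : R := \sum_(i < n | carnot_weight G i == 1%N) u 0 i * v 0 i.

Lemma hdotD v u w : hdot v (u + w) = hdot v u + hdot v w.
Proof. by rewrite /hdot -big_split /=; apply: eq_bigr => i _; rewrite mxE mulrDl. Qed.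

Lemma hdotZ v (c : R) u : hdot v (c *: u) = c * hdot v u.
Proof. by rewrite /hdot mulr_sumr; apply: eq_bigr => i _; rewrite mxE mulrA. Qed.

Lemma Dind_sum u phi : test_function phi ->
  Dind G E u phi = \sum_i u 0 i * Dind G E (delta_mx 0 i) phi.
Proof.
move=> tf; rewrite {1}(row_sum_delta u).
elim/big_ind2 : _ => [|x a y c <- <-|i _].
- by rewrite -(scale0r (0 : 'rV[R]_n)) Dind_scalel// mul0r.
- exact: Dind_addl.
- exact: Dind_scalel.
Qed.

(** Holds even if the integral of [phi] is infinite, the real-valued integrals
    being then both zero. *)
Lemma Rintegral_scale_nonneg (P : {measure set 'rV[R]_n -> \bar R}) phi (c : R) :
  test_function phi -> (forall p, 0 <= phi p) ->
  \int[P]_p (phi p * c) = c * \int[P]_p phi p.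
Proof.
move=> tf phi0.
have mphi := continuous_measurable_rV (test_function_continuous tf).
have pos (d : R) : 0 <= d -> (\int[P]_p (phi p * d)%:E = d%:E * \int[P]_p (phi p)%:E)%E.
  move=> d0; rewrite -ge0_integralZl_EFin//.
  - by apply: eq_integral => p _; rewrite -EFinM mulrC.
  - by move=> p _; rewrite lee_fin.
  - exact/measurable_EFinP.
have fineZ (d : R) (x : \bar R) : fine (d%:E * x) = d * fine x.
  case: (ltgtP d 0) => [d0|d0|->]; last by rewrite mul0e mul0r.
    by case: x => [r| |]; [|rewrite lt0_muley|rewrite lt0_muleNy];
      rewrite ?lte_fin//= mulr0.
  by case: x => [r| |]; [|rewrite gt0_muley|rewrite gt0_muleNy];
    rewrite ?lte_fin//= mulr0.
rewrite /Rintegral; have [c0|c0] := leP 0 c; first by rewrite pos// fineZ.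
have cN : 0 <= - c by rewrite oppr_ge0 ltW.
rewrite (_ : (fun p => _) = fun p => - (phi p * - c)%:E)%E; last first.
  by apply/funext => p; rewrite mulrN EFinN oppeK.
rewrite integral_ge0N; last by move=> p _; rewrite lee_fin mulr_ge0.
by rewrite pos// fineN fineZ mulNr opprK.
Qed.

(** By linearity in [u]: the coordinates of [u] of weight other than [1] vanish,
    and along the other basis vectors the derivative is given by the normal. *)
Lemma Dind_constant_normal P nu v : is_normal G E P nu ->
  {ae P, forall p, nu p = v} ->
  forall u phi, u \in layer G 1 -> test_function phi -> (forall p, 0 <= phi p) ->
  Dind G E u phi = hdot v u * \int[P]_p phi p.
Proof.
move=> [mnu _ _ nuE] nuv u phi uV tf phi0.
rewrite Dind_sum// (bigID (fun i => carnot_weight G i == 1%N))/= addrC big1.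
  rewrite add0r /hdot mulr_suml; apply: eq_bigr => i /eqP wi.
  rewrite nuE// -mulrA -(Rintegral_scale_nonneg P (v 0 i) tf phi0) /Rintegral; congr (_ * fine _).
  have mphi := continuous_measurable_rV (test_function_continuous tf).
  apply: ae_eq_integral => //.
  - apply/measurable_EFinP; apply: measurable_funM => //.
    exact: (measurableT_comp (coord_measurable i) mnu).
  - by apply/measurable_EFinP; apply: measurable_funM.
  - by apply: filterS nuv => p -> _.
by move=> i wi; rewrite (layer_coord0 uV wi) mul0r.
Qed.

End constant_normal.

Theorem theorem3p10 (R : realType) (n : nat) (G : carnotGroup R n) :
  type_star G ->
  forall E : set 'rV[R]_n, constant_normal G E -> vertical_halfspace G E.
Proof.
move=> star E cnE; split=> // v.
have [[mE measE] [P [nu [_ _ normE [d _ nud]]]]] := cnE.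
have DE := Dind_constant_normal mE normE nud.
apply: (@sum_layers_ind _ _ (Dind_eq0 G E)).
- by move=> phi tf; rewrite -(scale0r (0 : 'rV[R]_n)) Dind_scalel// mul0r.
- by move=> u w; exact: Dind_eq0_add.
move=> k k2 x xV.
have ker0 u : u \in layer G 1 -> hdot G d u = 0 -> Dind_eq0 G E u.
  move=> uV du; apply: (Dind_eq0_nonneg mE) => phi tf phi0.
  by rewrite (DE _ _ uV tf phi0) du mul0r.
have bracket0 u w : u \in layer G 1 -> w \in layer G 1 -> hdot G d w = 0 ->
    carnot_bracket G w (carnot_bracket G w u) = 0 ->
    Dind_eq0 G E (carnot_bracket G w u).
  move=> uV wV dw; apply: (Dind_bracket_eq0 mE (measE u uV) _ (ker0 w wV dw)).
  have int_ge0 phi : (forall p, 0 <= phi p) -> 0 <= \int[P]_p phi p.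
    by move=> phi0; apply: Rintegral_ge0.
  case: (leP 0 (hdot G d u)) => du; [left|right] => phi tf phi0.
    by rewrite (DE _ _ uV tf phi0) mulr_ge0// int_ge0.
  by rewrite (DE _ _ uV tf phi0) mulr_le0_ge0 ?(ltW du) ?int_ge0.
exact: (Inv_layer (@hdotD _ _ G d) (@hdotZ _ _ G d) (Dind_eq0_add mE)
  (Dind_eq0_scale mE) (Dind_eq0_br mE) ker0 bracket0 star k2 xV).
Qed.
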